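(* Let $1\le m<n$, let $\boldsymbol{\tilde B}_{m,n-m}=(\tilde b_{ij})$ be an $m\times(n-m)$ matrix with entries $\tilde b_{ij}\in\mathcal{X}$, and let $$\boldsymbol{\tilde A}=(\boldsymbol{\tilde I}_m\;\boldsymbol{\tilde B}_{m,n-m})=\begin{pmatrix}\tilde1&\tilde0&\cdots&\tilde0&\tilde b_{11}&\cdots&\tilde b_{1,n-m}\\\tilde0&\tilde1&\cdots&\tilde0&\tilde b_{21}&\cdots&\tilde b_{2,n-m}\\\vdots&\vdots&&\vdots&\vdots&&\vdots\\\tilde0&\tilde0&\cdots&\tilde1&\tilde b_{m1}&\cdots&\tilde b_{m,n-m}\end{pmatrix}\in\mathcal{X}^{m\times n}.$$ For $1\le i\le n-m$ and $1\le j\le5$ let $\boldsymbol{\tilde\zeta}_{ij}\in\mathcal{X}^n$ be the vector whose $k$-th entry is $-\tilde b_{ki}\tilde e_j$ for $1\le k\le m$, whose $(m+i)$-th entry is $\tilde e_j$, and whose remaining entries are $\tilde 0$. Then the solutions $\boldsymbol{\tilde x}\in\mathcal{X}^n$ of $\boldsymbol{\tilde A}\boldsymbol{\tilde x}=\boldsymbol{\tilde 0}$ are exactly those given by the formula $$\boldsymbol{\tilde x}=\sum_{i=1}^{n-m}\sum_{j=1}^5c_{ij}\boldsymbol{\tilde\zeta}_{ij},\qquad c_{ij}\in\mathbb{R}.$$ Furthermore, $\boldsymbol{\tilde A}\boldsymbol{\tilde x}=\boldsymbol{\tilde b}$ is consistent (has at least one solution) for any $\boldsymbol{\tilde b}\in\mathcal{X}^m$.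 If $\boldsymbol{\tilde\zeta}^*$ is a solution of $\boldsymbol{\tilde A}\boldsymbol{\tilde x}=\boldsymbol{\tilde b}$, then the solution set of $\boldsymbol{\tilde A}\boldsymbol{\tilde x}=\boldsymbol{\tilde b}$ is the set of all fuzzy vectors of the form $$\boldsymbol{\tilde x}=\boldsymbol{\tilde\zeta}^*+\sum_{i=1}^{n-m}\sum_{j=1}^5c_{ij}\boldsymbol{\tilde\zeta}_{ij},\qquad c_{ij}\in\mathbb{R}.$$
   Context: Gaussian-PDMF space $\mathcal{X}$: the set of functions $f:\mathbb{R}\to[0,1]$ with parameters $x\in\mathbb{R}$, $d^-,d^+>0$, $\mu^-,\mu^+\in\mathbb{R}$, given by $f(x)=1$, $f(\tau)=0$ for $\tau\le x-d^-$ or $\tau\ge x+d^+$, $f(\tau)=\int_{-\infty}^{\tan(\frac{\pi}{d^-}(\tau-x+d^-)-\frac{\pi}{2})}\frac{1}{\sqrt{2\pi}}e^{-\frac12(t-\mu^-)^2}dt$ for $\tau\in(x-d^-,x)$, and $f(\tau)=\int_{-\infty}^{\tan(\frac{\pi}{d^+}(x+d^+-\tau)-\frac{\pi}{2})}\frac{1}{\sqrt{2\pi}}e^{-\frac12(t-\mu^+)^2}dt$ for $\tau\in(x,x+d^+)$. Such an element is identified with its parameter tuple, written $\tilde x=\langle x;d^-,d^+,\mu^-,\mu^+\rangle$; two elements are equal iff all five parameters coincide. Operations on $\mathcal{X}$, for $\tilde x_i=\langle x_i;d_i^-,d_i^+,\mu_i^-,\mu_i^+\rangle$ and $\lambda\in\mathbb{R}$: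 $\tilde x_1+\tilde x_2=\langle x_1+x_2;d_1^-d_2^-,d_1^+d_2^+,\mu_1^-+\mu_2^-,\mu_1^++\mu_2^+\rangle$; $\lambda\tilde x=\langle\lambda x;(d^-)^\lambda,(d^+)^\lambda,\lambda\mu^-,\lambda\mu^+\rangle$; $\tilde x_1\tilde x_2=\langle x_1x_2;(d_1^-)^{\ln d_2^-},(d_1^+)^{\ln d_2^+},\mu_1^-\mu_2^-,\mu_1^+\mu_2^+\rangle$. With these operations $\mathcal{X}$ is a real vector space and a commutative ring, with zero $\tilde 0=\langle0;1,1,0,0\rangle$ and multiplicative identity $\tilde1=\langle1;e,e,1,1\rangle$ ($e$ is Euler's number). The standard basis over $\mathbb{R}$ is $\tilde e_1=\langle1;1,1,0,0\rangle$, $\tilde e_2=\langle0;e,1,0,0\rangle$, $\tilde e_3=\langle0;1,e,0,0\rangle$, $\tilde e_4=\langle0;1,1,1,0\rangle$, $\tilde e_5=\langle0;1,1,0,1\rangle$. $\mathcal{X}^n$ is the set of $n$-dimensional column vectors over $\mathcal{X}$ with entrywise addition and real scalar multiplication; $\boldsymbol{\tilde 0}=(\tilde 0,\dots,\tilde 0)^T$. $\boldsymbol{\tilde I}_m$ is the $m\times m$ matrix with $\tilde 1$ on the diagonal and $\tilde 0$ elsewhere. For $\boldsymbol{\tilde A}=(\tilde a_{ij})\in\mathcal{X}^{m\times n}$ and $\boldsymbol{\tilde x}\in\mathcal{X}^n$, $\boldsymbol{\tilde A}\boldsymbol{\tilde x}\in\mathcal{X}^m$ has $i$-th entry $\sum_{k=1}^n\tilde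 a_{ik}\tilde x_k$. *)

(* Defs.v *)
From HB Require Import structures.
From mathcomp Require Import all_boot all_order all_algebra.
From mathcomp Require Import all_classical all_reals all_analysis.
Import Order.TTheory GRing.Theory Num.Theory.

Set Implicit Arguments.
Unset Strict Implicit.
Unset Printing Implicit Defensive.

Local Open Scope ring_scope.

(* A Gaussian-PDMF <x; d^-, d^+, mu^-, mu^+>. It is identified with its tuple of
   parameters, so equality is equality of the five parameters; the function
   R -> [0, 1] it stands for is [membership] below. *)
Record gpdmf (R : realType) := GPDMF {
  peak : R;
  lwidth : {posnum R};
  rwidth : {posnum R};
  lmean : R;
  rmean : R }.

Section Membership.
Variable R : realType.

Definition gauss_cdf (mu a : R) : R :=
  \int[lebesgue_measure]_(t in [set t : R | t <= a])
    ((Num.sqrt (2 * pi))^-1 * expR (- (2^-1 * (t - mu) ^+ 2))).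

Definition membership (u : gpdmf R) (tau : R) : R :=
  let x := peak u in
  let dl := (lwidth u)%:num in
  let dr := (rwidth u)%:num in
  if tau == x then 1
  else if (tau <= x - dl) || (x + dr <= tau) then 0
  else if tau < x then
    gauss_cdf (lmean u) (tan (pi / dl * (tau - x + dl) - pi / 2))
  else
    gauss_cdf (rmean u) (tan (pi / dr * (x + dr - tau) - pi / 2)).

End Membership.

Coercion membership : gpdmf >-> Funclass.

Section Structure.
Variable R : realType.
Implicit Types (u v w : gpdmf R) (a b : R) (d : {posnum R}).

Definition gpdmf_tuple u := (peak u, lwidth u, rwidth u, lmean u, rmean u).
Definition tuple_gpdmf (p : R * {posnum R} * {posnum R} * R * R) : gpdmf R :=
  let: (x, dl, dr, ml, mr) := p in GPDMF x dl dr ml mr.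

Lemma gpdmf_tupleK : cancel gpdmf_tuple tuple_gpdmf.
Proof. by case. Qed.

HB.instance Definition _ := Choice.copy (gpdmf R) (can_type gpdmf_tupleK).

Lemma gpdmf_eq u v : peak u = peak v ->
  (lwidth u)%:num = (lwidth v)%:num -> (rwidth u)%:num = (rwidth v)%:num ->
  lmean u = lmean v -> rmean u = rmean v -> u = v.
Proof.
case: u v => [x dl dr ml mr] [x' dl' dr' ml' mr'] /=.
by move=> -> /val_inj -> /val_inj -> -> ->.
Qed.

Definition width_powR d a : {posnum R} := PosNum (powR_gt0 a (gt0 d)).

Definition gpdmf_zero : gpdmf R := GPDMF 0 1%:pos 1%:pos 0 0.

Definition gpdmf_one : gpdmf R :=
  GPDMF 1 (PosNum (expR_gt0 1)) (PosNum (expR_gt0 1)) 1 1.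

Definition gpdmf_add u v : gpdmf R :=
  GPDMF (peak u + peak v)
    ((lwidth u)%:num * (lwidth v)%:num)%:pos ((rwidth u)%:num * (rwidth v)%:num)%:pos
    (lmean u + lmean v) (rmean u + rmean v).

Definition gpdmf_scale a u : gpdmf R :=
  GPDMF (a * peak u) (width_powR (lwidth u) a) (width_powR (rwidth u) a)
    (a * lmean u) (a * rmean u).

Definition gpdmf_opp u : gpdmf R := gpdmf_scale (-1) u.

Definition gpdmf_mul u v : gpdmf R :=
  GPDMF (peak u * peak v)
    (width_powR (lwidth u) (ln (lwidth v)%:num))
    (width_powR (rwidth u) (ln (rwidth v)%:num))
    (lmean u * lmean v) (rmean u * rmean v).

Fact gpdmf_addA : associative gpdmf_add.
Proof.
by move=> u v w; apply: gpdmf_eq => /=; rewrite ?addrA ?mulrA.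
Qed.

Fact gpdmf_addC : commutative gpdmf_add.
Proof.
by move=> u v; apply: gpdmf_eq => /=; rewrite 1?addrC // mulrC.
Qed.

Fact gpdmf_add0 : left_id gpdmf_zero gpdmf_add.
Proof. by move=> u; apply: gpdmf_eq => /=; rewrite ?add0r ?mul1r. Qed.

Fact gpdmf_addN : left_inverse gpdmf_zero gpdmf_opp gpdmf_add.
Proof.
move=> u; apply: gpdmf_eq => /=; rewrite ?mulN1r ?addNr //;
  by rewrite powR_inv1 ?mulVf.
Qed.

HB.instance Definition _ := GRing.isZmodule.Build (gpdmf R)
  gpdmf_addA gpdmf_addC gpdmf_add0 gpdmf_addN.

Fact gpdmf_mulA : associative gpdmf_mul.
Proof.
move=> u v w; apply: gpdmf_eq => /=; rewrite ?mulrA //;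
  by rewrite ln_powR mulrC powRrM.
Qed.

Fact gpdmf_mulC : commutative gpdmf_mul.
Proof.
move=> u v; apply: gpdmf_eq => /=; rewrite 1?mulrC //;
  by rewrite /powR !gt_eqF // mulrC.
Qed.

Fact gpdmf_mul1 : left_id gpdmf_one gpdmf_mul.
Proof.
by move=> u; apply: gpdmf_eq => /=; rewrite ?mul1r // -expRM mul1r lnK ?posrE.
Qed.

Fact gpdmf_mulDl : left_distributive gpdmf_mul gpdmf_add.
Proof.
by move=> u v w; apply: gpdmf_eq => /=; rewrite ?mulrDl // powRM.
Qed.

Fact gpdmf_one_neq0 : gpdmf_one != gpdmf_zero.
Proof. by apply/eqP => -[/eqP]; rewrite oner_eq0. Qed.

HB.instance Definition _ := GRing.Zmodule_isComNzRing.Build (gpdmf R)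
  gpdmf_mulA gpdmf_mulC gpdmf_mul1 gpdmf_mulDl gpdmf_one_neq0.

Fact gpdmf_scaleA a b u :
  gpdmf_scale a (gpdmf_scale b u) = gpdmf_scale (a * b) u.
Proof.
by apply: gpdmf_eq => /=; rewrite ?mulrA // mulrC powRrM.
Qed.

Fact gpdmf_scale1 : left_id 1 gpdmf_scale.
Proof. by move=> u; apply: gpdmf_eq => /=; rewrite ?mul1r ?powRr1. Qed.

Fact gpdmf_scaleDr : right_distributive gpdmf_scale +%R.
Proof.
by move=> a u v; apply: gpdmf_eq => /=; rewrite ?mulrDr // powRM.
Qed.

Fact gpdmf_scaleDl u : {morph gpdmf_scale^~ u : a b / a + b}.
Proof.
move=> a b; apply: gpdmf_eq => /=; rewrite ?mulrDl //;
  by rewrite powRD // (gt_eqF (gt0 _)) implybT.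
Qed.

HB.instance Definition _ := GRing.Zmodule_isLmodule.Build R (gpdmf R)
  gpdmf_scaleA gpdmf_scale1 gpdmf_scaleDr gpdmf_scaleDl.

End Structure.

Section LinearSystem.
Variable R : realType.

Definition gpdmf_basis : 5.-tuple (gpdmf R) :=
  let e := PosNum (expR_gt0 (1 : R)) in
  [tuple GPDMF 1 1%:pos 1%:pos 0 0;
         GPDMF 0 e 1%:pos 0 0;
         GPDMF 0 1%:pos e 0 0;
         GPDMF 0 1%:pos 1%:pos 1 0;
         GPDMF 0 1%:pos 1%:pos 0 1].

(* Matrices over gpdmf R are in the library only a module over gpdmf R itself,
   hence an explicit entrywise scaling by reals. *)
Definition scale_real m n (a : R) (M : 'M[gpdmf R]_(m, n)) :
  'M[gpdmf R]_(m, n) := map_mx (fun u => a *: u) M.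

Variables (m n : nat) (lt_mn : (m < n)%N) (B : 'M[gpdmf R]_(m, n - m)).

Let eq_mn : (m + (n - m) = n)%N := subnKC (ltnW lt_mn).

Definition system_mx : 'M[gpdmf R]_(m, n) :=
  castmx (erefl m, eq_mn) (row_mx 1%:M B).

Definition zeta (i : 'I_(n - m)) (j : 'I_5) : 'cV[gpdmf R]_n :=
  let ej := tnth gpdmf_basis j in
  castmx (eq_mn, erefl 1%N)
    (col_mx (\col_(k < m) - (B k i * ej))
            (\col_(k < n - m) (if k == i then ej else 0))).

Definition zeta_comb (c : 'I_(n - m) -> 'I_5 -> R) : 'cV[gpdmf R]_n :=
  \sum_(i < n - m) \sum_(j < 5) scale_real (c i j) (zeta i j).

End LinearSystem.

(* Main.v *)
Require Import Defs.
From mathcomp Require Import all_boot all_order all_algebra.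
From mathcomp Require Import all_classical all_reals all_analysis.
Import Order.TTheory GRing.Theory Num.Theory.
Local Open Scope ring_scope.

(** Split a vector of size [n] into its first [m] entries [u] and its last
    [n - m] entries [v]. Since the left block of [A] is the identity,
    [A x = u + B v] ([system_mx_mul]). Hence the homogeneous solutions are the
    vectors [(- B v, v)] with [v] arbitrary, and [(b, 0)] solves [A x = b].

    It remains to see that the combinations of the [zeta i j] are the vectors
    [(- B v, v)]. The ring product is bilinear over the reals ([gpdmf_scaleAr]),
    so the combination with coefficients [c] is [(- B v, v)] for the vector [v]
    whose [i]-th entry is [\sum_j c i j *: e_j] ([zeta_combE]). Every [v] arises
    in this way because the [e_j] span the space over the reals: the coordinates
    of an element are its peak, the logarithms of its two widths, and its two
    means ([gpdmf_coordE]). The affine statement follows by subtracting a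
    particular solution. *)

Lemma gpdmf_scaleAr (R : realType) (a : R) (u v : gpdmf R) :
  a *: (u * v) = u * (a *: v).
Proof.
by apply: gpdmf_eq => /=; rewrite 1?mulrCA // ln_powR mulrC powRrM.
Qed.

(** Real coordinates of a Gaussian-PDMF in the standard basis. A width [d]
    contributes [ln d], since widths add multiplicatively. *)
Definition gpdmf_coord (R : realType) (u : gpdmf R) (j : 'I_5) : R :=
  tnth [tuple peak u; ln (lwidth u)%:num; ln (rwidth u)%:num; lmean u; rmean u]
    j.

Lemma gpdmf_coordE (R : realType) (u : gpdmf R) :
  \sum_(j < 5) gpdmf_coord R u j *: tnth (gpdmf_basis R) j = u.
Proof.
rewrite !big_ord_recl big_ord0 /gpdmf_coord !(tnth_nth 0) /=.
by apply: gpdmf_eq => /=;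
  rewrite ?powR1 -?expRM ?mul1r ?lnK ?posrE ?mulr1 ?mulr0 ?mul1r ?addr0 ?add0r.
Qed.

Section BlockForm.
Variables (R : realType) (m n : nat) (lt_mn : (m < n)%N).
Variable B : 'M[gpdmf R]_(m, n - m).

(** The vector of size [n] with upper block [u] and lower block [v]. *)
Definition stack_cV (u : 'cV[gpdmf R]_m) (v : 'cV[gpdmf R]_(n - m)) :
    'cV[gpdmf R]_n :=
  castmx (subnKC (ltnW lt_mn), erefl 1%N) (col_mx u v).

Lemma stack_cV_surj (x : 'cV[gpdmf R]_n) : exists u v, x = stack_cV u v.
Proof.
pose y := castmx (esym (subnKC (ltnW lt_mn)), erefl 1%N) x.
by exists (usubmx y), (dsubmx y); rewrite /stack_cV vsubmxK castmxKV.
Qed.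

Lemma system_mx_mul u v : system_mx lt_mn B *m stack_cV u v = u + B *m v.
Proof.
rewrite /system_mx /stack_cV; move: (subnKC _) B u v.
(* The dimension [n] can be substituted once [n - m] is a variable. *)
move: (n - m)%N => k eq_n C u v; case: _ / eq_n.
by rewrite !castmx_id mul_row_col mul1mx.
Qed.

Lemma system_mx_stack0 (b : 'cV[gpdmf R]_m) :
  system_mx lt_mn B *m stack_cV b 0 = b.
Proof. by rewrite system_mx_mul mulmx0 addr0. Qed.

Lemma zeta_combE (c : 'I_(n - m) -> 'I_5 -> R) :
  let v := \col_(i < n - m) \sum_(j < 5) c i j *: tnth (gpdmf_basis R) j in
  zeta_comb lt_mn B c = stack_cV (- (B *m v)) v.
Proof.
rewrite /zeta_comb /zeta /stack_cV /=; move: (subnKC _) B c.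
move: (n - m)%N => p eq_n C c; case: _ / eq_n.
apply/matrixP => k l; rewrite castmx_id summxE.
under eq_bigr => i _.
  rewrite summxE; under eq_bigr => j _ do rewrite /scale_real castmx_id mxE.
  over.
case: (split_ordP k) => k' ->.
  rewrite col_mxEu !mxE -sumrN; apply: eq_bigr => i _.
  rewrite mxE mulr_sumr -sumrN; apply: eq_bigr => j _.
  by rewrite col_mxEu mxE scalerN gpdmf_scaleAr.
rewrite col_mxEd mxE (bigD1 k') //= [X in _ + X]big1 ?addr0 => [|i ne_ik].
  by apply: eq_bigr => j _; rewrite col_mxEd mxE eqxx.
apply: big1 => j _.
by rewrite col_mxEd mxE eq_sym (negPf ne_ik) scaler0.
Qed.

Lemma system_mx_kerP (x : 'cV[gpdmf R]_n) :
  system_mx lt_mn B *m x = 0 <->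
  exists c : 'I_(n - m) -> 'I_5 -> R, x = zeta_comb lt_mn B c.
Proof.
split=> [|[c ->]]; last by rewrite zeta_combE system_mx_mul addNr.
have [u [v ->]] := stack_cV_surj x.
rewrite system_mx_mul => /eqP; rewrite addr_eq0 => /eqP ->.
exists (fun i j => gpdmf_coord R (v i 0) j); rewrite zeta_combE.
suff -> : \col_(i < n - m) \sum_(j < 5)
    gpdmf_coord R (v i 0) j *: tnth (gpdmf_basis R) j = v by [].
by apply/colP => i; rewrite mxE gpdmf_coordE.
Qed.

End BlockForm.

Theorem theorem4p1 (R : realType) (m n : nat) (m_gt0 : (1 <= m)%N)
    (lt_mn : (m < n)%N) (B : 'M[gpdmf R]_(m, n - m)) :
  let A := system_mx lt_mn B in
  [/\ forall x : 'cV[gpdmf R]_n,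
        A *m x = 0 <->
        exists c : 'I_(n - m) -> 'I_5 -> R, x = zeta_comb lt_mn B c,
      forall b : 'cV[gpdmf R]_m, exists x : 'cV[gpdmf R]_n, A *m x = b
    & forall (b : 'cV[gpdmf R]_m) (zs : 'cV[gpdmf R]_n),
        A *m zs = b ->
        forall x : 'cV[gpdmf R]_n,
          A *m x = b <->
          exists c : 'I_(n - m) -> 'I_5 -> R, x = zs + zeta_comb lt_mn B c].
Proof.
move=> A; split=> [x | b | b zs Azs x]; first exact: system_mx_kerP.
  by exists (stack_cV R m n lt_mn b 0); apply: system_mx_stack0.
split=> [Ax | [c ->]].
  have [|c xE] := (system_mx_kerP R m n lt_mn B (x - zs)).1.
    by rewrite mulmxBr Ax Azs subrr.
  by exists c; rewrite -xE addrC subrK.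
rewrite mulmxDr Azs (system_mx_kerP R m n lt_mn B _).2 ?addr0 //.
by exists c.
Qed.
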